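(* Let $H_{\mathrm{cor},\mathbb{F}_2}$ be the corner hypergraph of the group $\mathbb{F}_2 = \mathbb{Z}/2\mathbb{Z}$. Then $\beta(H_{\mathrm{cor},\mathbb{F}_2}^{\boxtimes 2}) \geq 11$ and $\beta(H_{\mathrm{cor},\mathbb{F}_2}^{\boxtimes 3}) \geq 39$; as a consequence, $\Theta(H_{\mathrm{cor},\mathbb{F}_2}) \geq \sqrt[3]{39}$.
   Context: A directed $k$-uniform hypergraph is a pair $H=(V,E)$ with $V$ a finite set and $E$ a set of $k$-tuples of elements of $V$. The strong product $G\boxtimes H$ of directed $k$-uniform hypergraphs $G=(V_G,E_G)$, $H=(V_H,E_H)$ has vertex set $V_G\times V_H$, and $((g_1,h_1),\dots,(g_k,h_k))$ is an edge iff either ($g_1=\dots=g_k$ and $(h_1,\dots,h_k)\in E_H$), or ($(g_1,\dots,g_k)\in E_G$ and $h_1=\dots=h_k$), or ($(g_1,\dots,g_k)\in E_G$ and $(h_1,\dots,h_k)\in E_H$). $H^{\boxtimes n}$ is the $n$-fold strong product of $H$ with itself. An independent set of $H$ is a set $S\subseteq V$ such that no edge has all its coordinates in $S$; $\alpha(H)$ is the maximum size of an independent set. The Shannon capacity is $\Theta(H)=\lim_{n\to\infty}\alpha(H^{\boxtimes n})^{1/n}$. For a finite abelian group $G$, the corner hypergraph $H_{\mathrm{cor},G}$ is the directed $3$-uniform hypergraph with vertex set $G\times G$ and edge set $\{((g_1,g_2),(g_1+\lambda,g_2),(g_1,g_2+\lambda)) : g_1,g_2,\lambda\in G,\ \lambda\neq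 0\}$. Combinatorial degeneration: for finite sets $I_1,\dots,I_k$ and $\Phi\subseteq\Psi\subseteq I_1\times\dots\times I_k$, we write $\Psi\unrhd\Phi$ if there are maps $u_i:I_i\to\mathbb{Z}$ ($i\in[k]$) such that for every $x=(x_1,\dots,x_k)\in\Psi\setminus\Phi$ we have $\sum_i u_i(x_i)>0$ and for every $x\in\Phi$ we have $\sum_i u_i(x_i)=0$. For a directed $k$-uniform hypergraph $H=(V,E)$, $\beta(H)$ is the largest size of a subset $S\subseteq V$ such that $E\cup\{(v,\dots,v):v\in V\}\unrhd\{(v,\dots,v):v\in S\}$. *)

(* Defs.v *)
From HB Require Import structures.
From mathcomp Require Import all_boot all_order all_algebra.
From mathcomp Require Import all_classical all_reals all_analysis.

Set Implicit Arguments.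
Unset Strict Implicit.
Unset Printing Implicit Defensive.

Import Order.TTheory GRing.Theory Num.Theory.
Import numFieldNormedType.Exports.

Local Open Scope ring_scope.

Record dhypergraph (k : nat) := DHypergraph {
  vertex : finType;
  edges : {set {ffun 'I_k -> vertex}}
}.

Arguments edges {k} H : rename.

Section Hypergraphs.
Variable k : nat.
Implicit Types G H : dhypergraph k.

Definition all_same (V : finType) (e : {ffun 'I_k -> V}) : bool :=
  [forall i, forall j, e i == e j].

Definition strong_product G H : dhypergraph k :=
  @DHypergraph k (vertex G * vertex H)%type
    [set e : {ffun 'I_k -> vertex G * vertex H} |
       let g := [ffun i => (e i).1] in
       let h := [ffun i => (e i).2] in
       [|| all_same g && (h \in edges H),
           (g \in edges G) && all_same h
         | (g \in edges G) && (h \in edges H)]].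

(* A single vertex and no edge: the unit of the strong product up to
   isomorphism, used only as the 0-th power. *)
Definition unit_hypergraph : dhypergraph k := @DHypergraph k unit finset.set0.

(* The 1st power is H itself, and the powers are bracketed to the right. *)
Definition strong_power H (n : nat) : dhypergraph k :=
  iterop n strong_product H unit_hypergraph.

Definition independent H (S : {set vertex H}) : bool :=
  [forall e in edges H, ~~ [forall i, e i \in S]].

Definition alpha H : nat := \max_(S : {set vertex H} | independent S) #|S|.

(* In a realType, lim is 0 when the limit does not exist, so a positive lower
   bound on shannon_capacity entails the convergence of the sequence. *)
Definition shannon_capacity (R : realType) H : R :=
  limn (fun n : nat => (alpha (strong_power H n))%:R `^ (n%:R^-1) : R).

Definition comb_degeneration (I : 'I_k -> finType)
    (Psi Phi : {set {dffun forall i : 'I_k, I i}}) : Prop :=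
  Phi \subset Psi /\
  exists u : forall i : 'I_k, I i -> int,
    (forall x, x \in Psi :\: Phi -> 0 < \sum_i u i (x i)) /\
    (forall x, x \in Phi -> \sum_i u i (x i) = 0).

Definition diag_tuples (V : finType) (S : {set V}) : {set {ffun 'I_k -> V}} :=
  [set [ffun=> v] | v in S]%SET.

Definition beta H : nat :=
  \max_(S : {set vertex H} |
        `[< @comb_degeneration (fun=> vertex H)
              (edges H :|: diag_tuples [set: vertex H]%SET) (diag_tuples S) >]) #|S|.

End Hypergraphs.

Definition corner (G : finZmodType) (g1 g2 l : G) : {ffun 'I_3 -> G * G} :=
  [ffun i => tnth [tuple (g1, g2); (g1 + l, g2); (g1, g2 + l)] i].

Definition corner_hypergraph (G : finZmodType) : dhypergraph 3 :=
  @DHypergraph 3 (G * G)%type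
    [set e | [exists g1 : G, exists g2 : G, exists l : G,
                (l != 0) && (e == corner g1 g2 l)]].

(* Main.v *)
Require Import Defs.
From mathcomp Require Import all_boot all_order all_algebra.
From mathcomp Require Import all_classical all_reals all_analysis.
From mathcomp Require Import zify ring lra.

(** Strong powers of the corner hypergraph of 'F_2 are the supports of matrix
    multiplication tensors, and a degeneration of such a power to a diagonal is
    a finite table of integers. The two lower bounds on [beta] are certified by
    explicit tables, checked by evaluation over all (possibly degenerate)
    corners.

    For the capacity, let [K] be the m-th power of a hypergraph [H] without
    loops, and let the weights [u] degenerate it to the diagonal over [S]. The
    coordinatewise sums of [u] degenerate the n-th power of [K] to the diagonal
    over [S ^ n]. These sums take O(n) values, so by pigeonhole all weights are
    constant on some [T] of size at least [#|S| ^ n / O(n) ^ k]. An edge inside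
    [T] would have total weight [0], as the diagonal tuples over [T] do, hence
    would itself be diagonal; so [T] is independent. Fekete's lemma gives the
    existence of the limit defining the capacity, and the polynomial factor
    disappears in the n-th root. *)

Set Implicit Arguments.
Unset Strict Implicit.
Unset Printing Implicit Defensive.

Import Order.TTheory GRing.Theory Num.Theory.
Import numFieldNormedType.Exports.

Local Open Scope ring_scope.

(** * Fekete's lemma and roots *)

Section Fekete.
Local Open Scope classical_set_scope.

(** The limit is the supremum of the ratios. Once [m.+1] has a ratio close to it, division with
    remainder and superadditivity transfer this ratio to all large [n], up to a bounded loss. *)
Lemma fekete (R : realType) (u : nat -> R) (C : R) :
  (forall m n, u m.+1 + u n.+1 <= u (m.+1 + n.+1)%N) ->
  (forall n, u n.+1 <= C * n.+1%:R) ->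
  exists2 L : R, u n / n%:R @[n --> \oo] --> L &
                 forall n, u n.+1 <= L * n.+1%:R.
Proof.
move=> uD uC; pose E : set R := range (fun n => u n.+1 / n.+1%:R).
have supE : has_sup E.
  split; first by exists (u 1%N / 1%:R); exists 0%N.
  by exists C => _ [n _ <-]; rewrite ler_pdivrMr ?ltr0n.
exists (sup E); last first.
  by move=> n; rewrite -ler_pdivrMr ?ltr0n//; apply: sup_upper_bound => //; exists n.
(* The remainder is [r.+1] because superadditivity is available at positive indices only. *)
have uMD m q r : q%:R * u m.+1 + u r.+1 <= u (q * m.+1 + r.+1)%N.
  elim: q => [|q IHq]; first by rewrite mul0r add0r.
  rewrite mulSn -addnA addnS; apply: le_trans (uD _ _); rewrite -addnS.
  by move: IHq; rewrite -natr1 mulrDl mul1r addnS; lra.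
apply/cvgrPdist_le => eps eps0.
have eps20 : 0 < eps / 2 by rewrite divr_gt0.
have [_ [m _ <-]] := sup_adherent eps20 supE.
pose a := u m.+1 / m.+1%:R; rewrite -/a => aL.
(* [B] bounds the loss due to the remainder, uniformly over its [m.+1] possible values. *)
pose D := \sum_(i < m.+1) `|u i.+1|; pose B := m.+1%:R * `|a| + D.
have B0 : 0 <= B by rewrite addr_ge0 ?mulr_ge0// sumr_ge0.
near=> n.
have n0 : (0 < n)%N by near: n; exact: nbhs_infty_gt.
have nR : 0 < n%:R :> R by rewrite ltr0n.
have nB : B <= eps / 2 * n%:R.
  rewrite -ler_pdivrMl// mulrC; apply: le_trans (ltW (archi_boundP _)) _.
    by rewrite divr_ge0// ltW.
  by rewrite ler_nat; near: n; exact: nbhs_infty_ge.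
have un : u n <= sup E * n%:R.
  rewrite -ler_pdivrMr//; apply: sup_upper_bound => //; exists n.-1 => //.
  by rewrite prednK.
have : a * n%:R - B <= u n.
  pose q := (n.-1 %/ m.+1)%N; pose r := (n.-1 %% m.+1)%N.
  have nE : n = (q * m.+1 + r.+1)%N by rewrite addnS -divn_eq prednK.
  have rm : (r < m.+1)%N by rewrite ltn_mod.
  rewrite {2}nE; apply: le_trans (uMD m q r).
  have -> : u m.+1 = a * m.+1%:R by rewrite /a divfK.
  have -> : q%:R * (a * m.+1%:R) = a * n%:R - r.+1%:R * a.
    by rewrite nE natrD natrM; ring.
  rewrite /B opprD addrA.
  have h1 : r.+1%:R * a <= m.+1%:R * `|a|.
    apply: le_trans (ler_norm _) _; rewrite normrM normr_nat ler_wpM2r//.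
    by rewrite ler_nat.
  have h2 : - u r.+1 <= D.
    rewrite /D (bigD1 (Ordinal rm))//=; apply: le_trans (ler_norm _) _.
    by rewrite normrN lerDl sumr_ge0.
  lra.
move=> ua; rewrite -(ler_pM2r nR) -{2}(gtr0_norm nR) -normrM mulrBl divfK ?gt_eqF//.
rewrite ger0_norm ?subr_ge0//.
have : (sup E - eps / 2) * n%:R <= a * n%:R by rewrite ler_pM2r// ltW.
rewrite mulrBl; lra.
Unshelve. all: by end_near. Qed.

(** The logarithm of [x] is twice that of its square root, to which [ln y < y] applies. *)
Lemma ln_le_2sqrt (R : realType) (x : R) : 0 < x -> ln x <= 2 * Num.sqrt x.
Proof.
move=> x0; have s0 : 0 < Num.sqrt x by rewrite sqrtr_gt0.
rewrite -{1}(sqr_sqrtr (ltW x0)) lnXn// mulr2n mulr_natl mulr2n.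
by rewrite lerD// ltW// ln_sublinear.
Qed.

Lemma linear_le_ln (R : realType) (d : R) (M k : nat) :
  (forall n, n.+1%:R * d <= k%:R * ln ((M * n.+1).*2.+1)%:R) -> d <= 0.
Proof.
move=> h; rewrite leNgt; apply/negP => d0.
(* Bounding the logarithm by a square root and squaring turns the hypothesis into
   [n.+1 * d ^ 2 <= B], which fails for the [n] chosen next. *)
pose B : R := 4 * k%:R ^+ 2 * (M.*2.+1)%:R.
pose n := Num.bound (B / d ^+ 2).
have : B / d ^+ 2 < n.+1%:R.
  apply: lt_le_trans (archi_boundP _) _; last by rewrite ler_nat.
  by rewrite divr_ge0 ?sqr_ge0// !mulr_ge0 ?sqr_ge0.
rewrite ltr_pdivrMr ?exprn_gt0// ltNge => /negP; apply.
rewrite -(ler_pM2l (ltr0Sn R n)).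
set y : R := ((M * n.+1).*2.+1)%:R.
have y0 : 0 < y by rewrite ltr0n.
have h1 : n.+1%:R * d <= k%:R * (2 * Num.sqrt y).
  by apply: le_trans (h n) _; rewrite ler_wpM2l// ln_le_2sqrt.
have h2 : (n.+1%:R * d) ^+ 2 <= (k%:R * (2 * Num.sqrt y)) ^+ 2.
  by rewrite ler_sqr ?nnegrE// ?mulr_ge0// ?sqrtr_ge0// ltW.
rewrite !exprMn sqr_sqrtr ?(ltW y0)// in h2.
have h3 : y <= (M.*2.+1)%:R * n.+1%:R.
  by rewrite /y -natrM ler_nat; nia.
rewrite mulrA -expr2; apply: le_trans h2 _.
rewrite /B.
have -> : k%:R ^+ 2 * (2 ^+ 2 * y) = 4 * k%:R ^+ 2 * y :> R by ring.
have -> : n.+1%:R * (4 * k%:R ^+ 2 * (M.*2.+1)%:R) =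
    4 * k%:R ^+ 2 * ((M.*2.+1)%:R * n.+1%:R) :> R by ring.
by rewrite ler_wpM2l// mulr_ge0 ?sqr_ge0.
Qed.

(** In logarithms, Fekete's lemma yields a limit [L] of [ln (a n) / n], and the last hypothesis
    bounds [n.+1 * (ln c - m.+1 * L)] by a multiple of a logarithm; hence [ln c - m.+1 * L] cannot
    be positive. *)
Lemma root_le_lim (R : realType) (a : nat -> nat) (c C M k m : nat) :
  (forall n, 0 < a n.+1)%N ->
  (forall i j, a i.+1 * a j.+1 <= a (i.+1 + j.+1))%N ->
  (forall n, a n.+1 <= C ^ n.+1)%N ->
  (0 < c)%N ->
  (forall n, c ^ n.+1 <= (M * n.+1).*2.+1 ^ k * a (m.+1 * n.+1))%N ->
  c%:R `^ (m.+1%:R^-1) <= limn (fun n => (a n)%:R `^ (n%:R^-1) : R).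
Proof.
move=> a0 aD aC c0 ca.
have C0 : (0 < C)%N by have := leq_trans (a0 0%N) (aC 0%N); rewrite expn1.
have ln_nat (i j : nat) : (0 < i)%N -> (i <= j)%N -> ln (i%:R : R) <= ln j%:R.
  move=> i0 ij; rewrite ler_ln ?posrE ?ltr0n ?ler_nat//; exact: leq_trans ij.
pose u n : R := ln (a n)%:R.
have [L uL leL] : exists2 L : R, u n / n%:R @[n --> \oo] --> L &
                 forall n, u n.+1 <= L * n.+1%:R.
  apply: (@fekete _ u (ln C%:R)) => [i j|n]; rewrite /u.
    rewrite -lnM ?posrE ?ltr0n// -natrM; apply: ln_nat => //.
    by rewrite muln_gt0 !a0.
  rewrite mulrC mulr_natl -lnXn ?ltr0n// -natrX.
  exact: ln_nat.
have rootL : (fun n => (a n)%:R `^ (n%:R^-1) : R) @ \oo --> expR L.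
  apply: cvg_trans (continuous_cvg _ (@continuous_expR R L) uL).
  (* [powR] is an exponential only for a nonzero base, and [a n] is known to be nonzero only for
     positive [n]. *)
  apply: near_eq_cvg; near=> n.
  have n0 : (0 < n)%N by near: n; exact: nbhs_infty_gt.
  by rewrite /powR /u -(prednK n0) pnatr_eq0 gtn_eqF// mulrC.
rewrite (cvg_lim _ rootL)//.
rewrite /powR pnatr_eq0 gtn_eqF// ler_expR ler_pdivrMl ?ltr0n//.
rewrite -subr_le0; apply: (@linear_le_ln _ _ M k) => n.
rewrite mulrBr lerBlDr.
have -> : n.+1%:R * ln c%:R = ln (c ^ n.+1)%:R :> R
  by rewrite natrX lnXn ?ltr0n// mulr_natl.
have p0 : (0 < (M * n.+1).*2.+1 ^ k)%N by rewrite expn_gt0.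
apply: le_trans (ln_nat _ _ _ (ca n)) _; first by rewrite expn_gt0 c0.
rewrite natrM lnM ?posrE ?ltr0n//; last by rewrite mulnS addSn.
rewrite (natrX R _ k) lnXn ?ltr0n// -[_ *+ k]mulr_natl.
rewrite lerD2l.
have := leL (m.+1 * n.+1).-1; rewrite prednK ?muln_gt0// natrM => /le_trans; apply.
lra.
Unshelve. all: by end_near. Qed.

End Fekete.

(** * Strong products, independence and degenerations *)

Section WeakEdges.
Variable k : nat.
Implicit Types G H K : dhypergraph k.

(** This is the larger set in the degenerations defining [beta]. In these terms the three cases of
    the strong product merge into one componentwise condition, [weak_edge_prod]. *)
Definition weak_edge H (e : {ffun 'I_k -> vertex H}) : bool :=
  all_same e || (e \in edges H).

Definition loopless H : Prop :=
  forall e, e \in edges H -> ~~ all_same e.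

Definition prod1 (U V : finType) (e : {ffun 'I_k -> U * V}) : {ffun 'I_k -> U} :=
  [ffun i => (e i).1].
Definition prod2 (U V : finType) (e : {ffun 'I_k -> U * V}) : {ffun 'I_k -> V} :=
  [ffun i => (e i).2].

Lemma all_sameP (V : finType) (e : {ffun 'I_k -> V}) :
  reflect (forall i j, e i = e j) (all_same e).
Proof.
apply: (iffP forallP) => [h i j|h i]; first by have /forallP/(_ j)/eqP := h i.
by apply/forallP => j; apply/eqP.
Qed.

Lemma all_same_prod (U V : finType) (e : {ffun 'I_k -> U * V}) :
  all_same e = all_same (prod1 e) && all_same (prod2 e).
Proof.
apply/all_sameP/andP => [h|[/all_sameP h1 /all_sameP h2] i j].
  by split; apply/all_sameP => i j; rewrite !ffunE (h i j).
have := h1 i j; have := h2 i j; rewrite !ffunE.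
by case: (e i) (e j) => [a b] [c d] /= -> ->.
Qed.

Lemma edge_prod G H (e : {ffun 'I_k -> vertex (strong_product G H)}) :
  (e \in edges (strong_product G H)) =
  [|| all_same (prod1 e) && (prod2 e \in edges H),
      (prod1 e \in edges G) && all_same (prod2 e)
    | (prod1 e \in edges G) && (prod2 e \in edges H)].
Proof. by rewrite inE. Qed.

Lemma weak_edge_prod G H (e : {ffun 'I_k -> vertex (strong_product G H)}) :
  weak_edge e = weak_edge (H := G) (prod1 e) && weak_edge (H := H) (prod2 e).
Proof.
rewrite /weak_edge edge_prod all_same_prod.
by do 2![case: (all_same _)]; do 2![case: (_ \in edges _)].
Qed.

Lemma loopless_prod G H : loopless G -> loopless H -> loopless (strong_product G H).
Proof.
move=> lG lH e; rewrite edge_prod all_same_prod.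
have := lG (prod1 e); have := lH (prod2 e).
case: (_ \in edges H) => [/(_ isT) /negbTE ->|_]; first by rewrite !andbF.
by case: (_ \in edges G) => [/(_ isT) /negbTE ->|_] //; rewrite !andbF.
Qed.

Lemma strong_powerS H n :
  strong_power H n.+2 = strong_product H (strong_power H n.+1).
Proof. by []. Qed.

Lemma loopless_power H n : loopless H -> loopless (strong_power H n.+1).
Proof.
by move=> lH; elim: n => // n IHn; rewrite strong_powerS; exact: loopless_prod.
Qed.

(** * Isomorphisms and exponent laws for strong powers *)

Definition isomorphic G H : Prop :=
  exists2 f : vertex G -> vertex H, bijective f &
    forall e : {ffun 'I_k -> vertex G},
      ([ffun i => f (e i)] \in edges H) = (e \in edges G).

Lemma isomorphic_refl G : isomorphic G G.
Proof.
exists id => [|e]; first by exists id.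
by have -> : [ffun i => e i] = e by apply/ffunP => i; rewrite ffunE.
Qed.

Lemma isomorphic_trans G H K : isomorphic G H -> isomorphic H K -> isomorphic G K.
Proof.
case=> f bf fE [g bg gE]; exists (g \o f); first exact: bij_comp.
move=> e; rewrite -fE -gE.
by have -> : [ffun i => (g \o f) (e i)] = [ffun i => g ([ffun j => f (e j)] i)]
  by apply/ffunP => i; rewrite !ffunE.
Qed.

Lemma all_same_inj (U V : finType) (f : U -> V) (e : {ffun 'I_k -> U}) :
  injective f -> all_same [ffun i => f (e i)] = all_same e.
Proof.
move=> fI; apply/all_sameP/all_sameP => h i j; last by rewrite !ffunE (h i j).
by have := h i j; rewrite !ffunE => /fI.
Qed.

Lemma isomorphic_prod G G' H H' :
  isomorphic G G' -> isomorphic H H' ->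
  isomorphic (strong_product G H) (strong_product G' H').
Proof.
case=> f bf fE [g bg gE]; exists (fun v => (f v.1, g v.2)).
  case: bf bg => [f' fK f'K] [g' gK g'K].
  by exists (fun v => (f' v.1, g' v.2)) => -[a b] /=; rewrite ?fK ?gK ?f'K ?g'K.
move=> e; rewrite !edge_prod -fE -gE.
rewrite -(all_same_inj _ (bij_inj bf)) -(all_same_inj _ (bij_inj bg)).
set e1 := prod1 _; set e2 := prod2 _.
have -> : [ffun i => f (prod1 e i)] = e1 by apply/ffunP => i; rewrite !ffunE.
by have -> : [ffun i => g (prod2 e i)] = e2 by apply/ffunP => i; rewrite !ffunE.
Qed.

Lemma isomorphic_prodA G H K :
  isomorphic (strong_product (strong_product G H) K)
             (strong_product G (strong_product H K)).
Proof.
exists (fun v => (v.1.1, (v.1.2, v.2))).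
  by exists (fun v => ((v.1, v.2.1), v.2.2)); [case=> -[]|case=> ? []].
move=> e; rewrite !edge_prod !all_same_prod.
set a := prod1 _; set b := prod1 (prod2 _); set c := prod2 (prod2 _).
set a' := prod1 (prod1 e); set b' := prod2 (prod1 e); set c' := prod2 e.
have -> : a = a' by apply/ffunP => i; rewrite !ffunE.
have -> : b = b' by apply/ffunP => i; rewrite !ffunE.
have -> : c = c' by apply/ffunP => i; rewrite !ffunE.
by do 3![case: (all_same _)]; do 3![case: (_ \in edges _)].
Qed.

(** Powers are bracketed to the right, so regrouping the factors takes associativity, which is a
    relabelling of vertices. *)
Lemma isomorphic_powerD H m n :
  isomorphic (strong_product (strong_power H m.+1) (strong_power H n.+1))
             (strong_power H (m.+1 + n.+1)).
Proof.
elim: m => [|m IHm]; first exact: isomorphic_refl.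
rewrite addSn addSn !strong_powerS.
apply: isomorphic_trans (isomorphic_prodA _ _ _) _.
by apply: isomorphic_prod (isomorphic_refl _) _; rewrite -addSn.
Qed.

Lemma isomorphic_powerM H m n :
  isomorphic (strong_power (strong_power H m.+1) n.+1)
             (strong_power H (m.+1 * n.+1)).
Proof.
elim: n => [|n IHn]; first by rewrite muln1; exact: isomorphic_refl.
rewrite strong_powerS mulnS.
apply: isomorphic_trans (isomorphic_powerD _ _ _).
by apply: isomorphic_prod (isomorphic_refl _) _; exact: IHn.
Qed.

(** * Independence number of products and powers *)

Lemma independentP H (S : {set vertex H}) :
  reflect (forall e, e \in edges H -> ~ (forall i, e i \in S)) (independent S).
Proof.
apply: (iffP forallP) => h e.
  by move=> He /forallP; apply/negP; have /implyP := h e; apply.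
by apply/implyP => /h He; apply/forallP.
Qed.

Lemma leq_alpha H (S : {set vertex H}) : independent S -> (#|S| <= alpha H)%N.
Proof. by move=> iS; exact: bigop.leq_bigmax_cond. Qed.

(** The empty set is a candidate for the maximum: for [k = 0] the empty tuple lies in it, but is
    constant and hence not an edge. *)
Lemma alpha_witness H : loopless H ->
  exists2 S : {set vertex H}, independent S & #|S| = alpha H.
Proof.
move=> lH; have i0 : independent (finset.set0 : {set vertex H}).
  apply/independentP => e eE e0; case/negP: (lH e eE).
  by apply/all_sameP => i j; have := e0 i; rewrite inE.
exists [arg max_(S > finset.set0 | independent S) #|S|]; first by case: arg_maxnP.
by rewrite /alpha (bigop.bigmax_eq_arg _ i0).
Qed.

Lemma leq_alpha_iso G H : loopless G -> isomorphic G H -> (alpha G <= alpha H)%N.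
Proof.
move=> lG [f [g fK gK] fE]; have [S /independentP iS <-] := alpha_witness lG.
rewrite -(card_imset S (can_inj fK)); apply: leq_alpha; apply/independentP => e eE eS.
apply: (iS [ffun i => g (e i)]) => [|i].
  rewrite -fE.
  by have -> : [ffun i => f ([ffun j => g (e j)] i)] = e
    by apply/ffunP => i; rewrite !ffunE gK.
by rewrite ffunE; have /imsetP [v vS ->] := eS i; rewrite fK.
Qed.

(** A product of independent sets is independent, since every edge of the product projects to an
    edge in at least one factor. *)
Lemma leq_alpha_prod G H : loopless G -> loopless H ->
  (alpha G * alpha H <= alpha (strong_product G H))%N.
Proof.
move=> lG lH; have [S /independentP iS <-] := alpha_witness lG.
have [T /independentP iT <-] := alpha_witness lH.
rewrite -cardsX; apply: (@leq_alpha (strong_product G H)); apply/independentP => e.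
rewrite edge_prod => eE eST.
have e1S i : prod1 e i \in S by have := eST i; rewrite ffunE inE => /andP[].
have e2T i : prod2 e i \in T by have := eST i; rewrite ffunE inE => /andP[].
by case/or3P: eE => /andP[g h]; [apply: iT h _|apply: iS g _|apply: iS g _].
Qed.

Lemma leq_alpha_powerD H m n : loopless H ->
  (alpha (strong_power H m.+1) * alpha (strong_power H n.+1) <=
     alpha (strong_power H (m.+1 + n.+1)))%N.
Proof.
move=> lH; have lm := loopless_power (n := m) lH; have ln := loopless_power (n := n) lH.
apply: leq_trans (leq_alpha_prod lm ln) _.
by apply: leq_alpha_iso (isomorphic_powerD _ _ _); exact: loopless_prod.
Qed.

Lemma alpha_le_card H : (alpha H <= #|vertex H|)%N.
Proof. by apply/bigop.bigmax_leqP => S _; exact: max_card. Qed.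

Lemma card_power H n : #|vertex (strong_power H n.+1)| = (#|vertex H| ^ n.+1)%N.
Proof.
elim: n => [|n IHn]; first by rewrite expn1.
by rewrite strong_powerS expnS -IHn -card_prod.
Qed.

Lemma alpha_gt0 H : loopless H -> (0 < #|vertex H|)%N -> (0 < alpha H)%N.
Proof.
move=> lH /card_gt0P [v _]; rewrite -(cards1 v); apply: leq_alpha.
apply/independentP => e /lH /negP eE eS; apply: eE; apply/all_sameP => i j.
by have /set1P -> := eS i; have /set1P -> := eS j.
Qed.

(* Weaker than [comb_degeneration] to [diag_tuples S], in that diagonal tuples
   outside [S] may have weight 0; this form is stable under products. *)
Definition degeneration H (S : {set vertex H}) (u : 'I_k -> vertex H -> int) :=
  [/\ forall v, v \in S -> \sum_i u i v = 0,
      forall e, weak_edge (H := H) e -> 0 <= \sum_i u i (e i)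
    & forall e, weak_edge (H := H) e -> \sum_i u i (e i) = 0 -> all_same e].

(** Both summands are nonnegative on weak edges, so a vanishing total makes both vanish and both
    projections constant. *)
Lemma degeneration_prod G H S T u v :
  @degeneration G S u -> @degeneration H T v ->
  @degeneration (strong_product G H) (finset.setX S T) (fun i x => u i x.1 + v i x.2).
Proof.
case=> u0 uge uE [v0 vge vE].
have split (e : {ffun 'I_k -> vertex (strong_product G H)}) :
    \sum_i (u i (e i).1 + v i (e i).2) =
    \sum_i u i (prod1 e i) + \sum_i v i (prod2 e i).
  by rewrite big_split; congr (_ + _); apply: eq_bigr => i _; rewrite ffunE.
split=> [[x y]|e|e]; rewrite ?weak_edge_prod.
- by rewrite inE => /andP[/u0 xS /v0 yT]; rewrite big_split /= xS yT.
- by case/andP=> /uge ue /vge ve; rewrite split addr_ge0.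
- case/andP=> we1 we2; rewrite split => /eqP.
  rewrite paddr_eq0 ?uge ?vge// => /andP[/eqP e1 /eqP e2].
  by rewrite all_same_prod uE ?vE.
Qed.

(** Weights add under products, so their bound grows only linearly in the exponent. *)
Lemma degeneration_power H S u M n : @degeneration H S u ->
  (forall i v, `|u i v| <= M%:Z) ->
  exists S' u', [/\ @degeneration (strong_power H n.+1) S' u',
    #|S'| = (#|S| ^ n.+1)%N & forall i v, `|u' i v| <= (M * n.+1)%:Z].
Proof.
move=> dS uM; elim: n => [|n [S' [u' [dS' cS' uM']]]].
  by exists S, u; split=> [||i v]; rewrite ?expn1 ?muln1.
exists (finset.setX S S'), (fun i x => u i x.1 + u' i x.2); split.
- exact: degeneration_prod.
- by rewrite cardsX cS' -expnS.
- move=> i v; rewrite mulnS PoszD; apply: le_trans (ler_normD _ _) _.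
  by rewrite lerD.
Qed.

(** A largest fibre works; [y0] makes the codomain inhabited so that one exists. *)
Lemma pigeonhole_fiber (T U : finType) (S : {set T}) (f : T -> U) (y0 : U) :
  exists y, (#|S| <= #|U| * #|[set x in S | f x == y]|)%N.
Proof.
exists [arg max_(y > y0) #|[set x in S | f x == y]|]; case: arg_maxnP => // y _ ymax.
rewrite -sum1_card (partition_big f predT)//= -sum_nat_const.
apply: leq_sum => z _; apply: leq_trans (ymax z isT).
by rewrite sum1dep_card cardsE.
Qed.

Lemma degeneration_alpha H S u M : loopless H -> @degeneration H S u ->
  (forall i v, `|u i v| <= M%:Z) -> (#|S| <= (M.*2.+1) ^ k * alpha H)%N.
Proof.
move=> lH [u0 _ uE] uM.
(* Shifting by [M] sends the weights injectively below [M.*2.+1], where [inord] does not fall back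
   to its default. *)
have bound_shift (z : int) : `|z| <= M%:Z -> (`|(z + M%:Z)%R| < M.*2.+1)%N.
  by rewrite ler_norml; lia.
have shift_inj (z t : int) : `|z| <= M%:Z -> `|t| <= M%:Z ->
    `|(z + M%:Z)%R|%N = `|(t + M%:Z)%R|%N -> z = t.
  by rewrite !ler_norml; lia.
pose f (v : vertex H) : {ffun 'I_k -> 'I_(M.*2.+1)} :=
  [ffun i => inord `|u i v + M%:Z|].
have [y Sy] := pigeonhole_fiber S f [ffun=> ord0]; apply: leq_trans Sy _.
rewrite card_ffun !card_ord leq_mul2l leq_alpha ?orbT//.
apply/independentP => e eE eT.
have we : weak_edge (H := H) e by rewrite /weak_edge eE orbT.
(* For [k = 0] every tuple is constant; otherwise some position [i0] provides a reference vertex. *)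
case/negP: (lH _ eE); case: (posnP k) => [k0|k0].
  by apply/all_sameP => i; have := ltn_ord i; lia.
have i0 := Ordinal k0.
(* Weights agree on the fibre, so [e] weighs as much as the constant tuple at [e i0], namely
   zero. *)
apply: uE => //; rewrite -[RHS](u0 (e i0)); last by have := eT i0; rewrite inE => /andP[].
apply: eq_bigr => i _.
have /eqP fE : f (e i) == f (e i0).
  by have := eT i; have := eT i0; rewrite !inE => /andP[_ /eqP ->] /andP[_ /eqP ->].
move/ffunP/(_ i)/(congr1 val): fE; rewrite !ffunE /= !inordK; first last.
- by apply: bound_shift; exact: uM.
- by apply: bound_shift; exact: uM.
by apply: shift_inj; exact: uM.
Qed.

End WeakEdges.

(** * From [beta] to the Shannon capacity *)

Section Beta.
Variable k : nat.
Implicit Types H : dhypergraph k.+1.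

Lemma diag_tuplesP H (S : {set vertex H}) (e : {ffun 'I_k.+1 -> vertex H}) :
  reflect (all_same e /\ e ord0 \in S) (e \in diag_tuples k.+1 S).
Proof.
apply: (iffP imsetP) => [[v vS ->]|[/all_sameP eE e0]].
  by split; [apply/all_sameP => i j|]; rewrite !ffunE.
by exists (e ord0) => //; apply/ffunP => i; rewrite ffunE; exact: eE.
Qed.

Lemma weak_edgeE H (e : {ffun 'I_k.+1 -> vertex H}) :
  weak_edge e = (e \in edges H :|: diag_tuples k.+1 [set: vertex H]%SET).
Proof.
rewrite inE orbC; congr (_ || _); apply/idP/diag_tuplesP => [eE|[]//].
by split; rewrite ?inE.
Qed.

Lemma beta_degeneration H : (0 < beta H)%N ->
  exists S u, @degeneration k.+1 H S u /\ #|S| = beta H.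
Proof.
pose P (S : {set vertex H}) := `[< @comb_degeneration k.+1 (fun=> vertex H)
  (edges H :|: diag_tuples k.+1 [set: vertex H]%SET) (diag_tuples k.+1 S) >].
have -> : beta H = \max_(S | P S) #|S| by [].
(* A maximum over an empty family is [0] by convention, against positivity of [beta]. *)
case: (pickP P) => [S0 PS0|P0]; last by rewrite big_pred0.
move=> _; rewrite (bigop.bigmax_eq_arg _ PS0).
case: arg_maxnP => // S /asboolP [_ [u [upos u0]]] _.
exists S, u; split=> //.
have diagS e : e \in diag_tuples k.+1 S -> all_same e by case/diag_tuplesP.
split=> [v vS|e|e].
- rewrite -[RHS](u0 [ffun=> v]); first by apply: eq_bigr => i _; rewrite ffunE.
  exact: imset_f.
- rewrite weak_edgeE => we; case: (boolP (e \in diag_tuples k.+1 S)) => [/u0 -> //|eS].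
  by apply/ltW/upos; rewrite inE eS.
- rewrite weak_edgeE => we e0; apply/diagS/negPn/negP => eS.
  by have := upos e; rewrite inE eS we e0 ltxx => /(_ isT).
Qed.

Lemma leq_beta H (S : {set vertex H}) (u : 'I_k.+1 -> vertex H -> int) :
  (forall v, v \in S -> \sum_i u i v = 0) ->
  (forall e, weak_edge (H := H) e -> e \notin diag_tuples k.+1 S ->
     0 < \sum_i u i (e i)) ->
  (#|S| <= beta H)%N.
Proof.
move=> u0 upos; apply: bigop.leq_bigmax_cond; apply/asboolP; split.
  apply/fintype.subsetP => e /diag_tuplesP[eE _]; rewrite -weak_edgeE.
  by rewrite /weak_edge eE.
exists u; split=> e; first by rewrite inE -weak_edgeE => /andP[eS we]; exact: upos.
case/imsetP => v vS ->; rewrite -[RHS](u0 v vS).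
by apply: eq_bigr => i _; rewrite ffunE.
Qed.

Lemma shannon_capacity_ge_beta (R : realType) H m : loopless H ->
  (0 < beta (strong_power H m.+1))%N ->
  (beta (strong_power H m.+1))%:R `^ (m.+1%:R^-1) <= shannon_capacity R H.
Proof.
move=> lH b0; have [S [u [dS cS]]] := beta_degeneration b0.
pose M := (\max_(x : 'I_k.+1 * vertex (strong_power H m.+1)) `|u x.1 x.2|)%N.
have uM i v : `|u i v| <= M%:Z.
  rewrite -abszE lez_nat.
  exact: (@bigop.leq_bigmax_cond _ predT (fun x => `|u x.1 x.2|%N) (i, v)).
(* [S] is nonempty, hence so is the power, hence so is [H]. *)
have V0 : (0 < #|vertex H|)%N.
  have := leq_trans b0 (leq_trans (eq_leq (esym cS)) (max_card _)).
  by rewrite card_power expn_gt0 orbF.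
apply: (@root_le_lim _ (fun n => alpha (strong_power H n)) _ #|vertex H| M k.+1) => //.
- move=> n; apply: alpha_gt0; first exact: loopless_power.
  by rewrite card_power expn_gt0 V0.
- by move=> i j; exact: leq_alpha_powerD.
- by move=> n; rewrite -card_power; exact: alpha_le_card.
- move=> n; have [S' [u' [dS' cS' uM']]] := degeneration_power n dS uM.
  rewrite -cS -cS'.
  have lm : loopless (strong_power H m.+1) by exact: loopless_power.
  have lmn := loopless_power (n := n) lm.
  apply: leq_trans (degeneration_alpha lmn dS' uM') _.
  by rewrite leq_mul2l leq_alpha_iso ?orbT//; exact: isomorphic_powerM.
Qed.

End Beta.

(** * Corner hypergraphs *)

Section Corner.
Variable G : finZmodType.

Lemma corner0 (g1 g2 : G) : corner g1 g2 0 = [ffun=> (g1, g2)].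
Proof. by apply/ffunP => i; rewrite !ffunE !addr0; case: i => -[|[|[]]]. Qed.

(** Constant triples are the corners with [l = 0]; this parametrization is what the finite checks
    enumerate. *)
Lemma weak_edge_corner (e : {ffun 'I_3 -> vertex (corner_hypergraph G)}) :
  weak_edge e -> exists g1 g2 l, e = corner g1 g2 l.
Proof.
case/orP => [/all_sameP eE|]; last first.
  rewrite inE => /existsP[g1 /existsP[g2 /existsP[l /andP[_ /eqP ->]]]].
  by exists g1, g2, l.
exists (e ord0).1, (e ord0).2, 0; rewrite corner0; apply/ffunP => i.
by rewrite ffunE (eE i ord0) -surjective_pairing.
Qed.

Lemma loopless_corner : loopless (corner_hypergraph G).
Proof.
move=> e; rewrite inE => /existsP[g1 /existsP[g2 /existsP[l /andP[l0 /eqP ->]]]].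
apply/negP => /all_sameP /(_ ord0 (lift ord0 ord0)); rewrite !ffunE /= => -[] /eqP.
by rewrite -subr_eq0 opprD addNKr oppr_eq0 (negPf l0).
Qed.

End Corner.

(** The actual weights are [w i v - c]; adding [c] in each of the three positions turns sign
    conditions into comparisons with [3 * c] in [nat], which evaluate directly. *)
Lemma leq_beta_nat (K : dhypergraph 3) (w : nat -> vertex K -> nat) (c : nat)
    (L : seq (vertex K)) :
  uniq L ->
  all (fun v => w 0 v + w 1 v + w 2 v == 3 * c)%N L ->
  (forall e : {ffun 'I_3 -> vertex K}, weak_edge e ->
     (3 * c < w 0 (e ord0) + w 1 (e (lift ord0 ord0)) + w 2 (e ord_max))%N
     \/ all_same e /\ e ord0 \in L) ->
  (size L <= beta K)%N.
Proof.
move=> uL /allP L0 wpos; rewrite -(card_uniqP uL) -cardsE.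
have sumE (e : 'I_3 -> vertex K) : \sum_(i < 3) ((w i (e i))%:Z - c%:Z) =
    (w 0 (e ord0) + w 1 (e (lift ord0 ord0)) + w 2 (e ord_max))%N%:Z - (3 * c)%N%:Z.
  rewrite !big_ord_recl big_ord0.
  rewrite (_ : lift ord0 (lift ord0 ord0) = ord_max); last exact: val_inj.
  by rewrite /= /bump/=; ring.
apply: (@leq_beta _ K _ (fun (i : 'I_3) v => (w i v)%:Z - c%:Z)) => [v|e].
  by rewrite inE => /L0 /eqP v0; rewrite (sumE (fun=> v)) v0 subrr.
move=> /wpos[h _|[eE eL] /diag_tuplesP[]]; last by rewrite inE.
by rewrite sumE subr_gt0 ltz_nat.
Qed.

(** * Computable certificates over ['F_2] *)

Definition all_F2 (P : 'F_2 -> bool) := P 0 && P 1.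

Lemma all_F2P (P : 'F_2 -> bool) : reflect (forall x, P x) (all_F2 P).
Proof.
apply: (iffP andP) => [[P0 P1] [[|[|//]] i]|h]; last by split.
  by rewrite (_ : Ordinal i = 0)//; exact: val_inj.
by rewrite (_ : Ordinal i = 1)//; exact: val_inj.
Qed.

Definition F2_pairs : seq ('F_2 * 'F_2) := [:: (0, 0); (0, 1); (1, 0); (1, 1)].

Local Notation corner_F2 := (corner_hypergraph 'F_2).

Definition lookup (t : seq (seq (seq nat))) (i x y : nat) : nat :=
  nth 0%N (nth [::] (nth [::] t i) x) y.

(* Both tables were found by a linear programming search. The entry [(i, x, y)]
   is the weight of the vertex [(x, y)] in position [i], shifted by a constant
   (2 for the square, 11 for the cube) that makes all entries natural numbers;
   the coordinates of [x] and of [y] are read as binary digits. *)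
Definition table2 : seq (seq (seq nat)) :=
  [:: [:: [:: 3; 1; 6; 4];
        [:: 2; 6; 0; 2];
        [:: 4; 3; 3; 2];
        [:: 2; 3; 4; 1]];
      [:: [:: 3; 2; 6; 4];
        [:: 1; 6; 3; 3];
        [:: 4; 2; 1; 2];
        [:: 2; 0; 4; 3]];
      [:: [:: 0; 3; 6; 4];
        [:: 3; 6; 3; 1];
        [:: 4; 1; 2; 2];
        [:: 2; 3; 4; 2]]]%N.

Definition weight2 (i : nat) (v : vertex (strong_power corner_F2 2)) : nat :=
  lookup table2 i (v.1.1 + 2 * v.2.1) (v.1.2 + 2 * v.2.2).

Definition vertex2 (x0 y0 x1 y1 : 'F_2) : vertex (strong_power corner_F2 2) :=
  ((x0, y0), (x1, y1)).

Definition support2 : seq (vertex (strong_power corner_F2 2)) :=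
  [seq v <- allpairs pair F2_pairs F2_pairs
  | weight2 0 v + weight2 1 v + weight2 2 v == 3 * 2]%N.

(** The 64 cases cover all weak edges of the square. Diagonal tuples outside the support must weigh
    strictly more than the threshold, as [beta] demands. *)
Lemma table2_positive :
  all_F2 (fun x0 => all_F2 (fun y0 => all_F2 (fun l0 =>
  all_F2 (fun x1 => all_F2 (fun y1 => all_F2 (fun l1 =>
    (3 * 2 < weight2 0 (vertex2 x0 y0 x1 y1)
      + weight2 1 (vertex2 (x0 + l0)%R y0 (x1 + l1)%R y1)
      + weight2 2 (vertex2 x0 (y0 + l0)%R x1 (y1 + l1)%R))%N
    || [&& l0 == 0, l1 == 0 & vertex2 x0 y0 x1 y1 \in support2])))))).
Proof. by vm_compute. Qed.

Lemma beta_corner_F2_square : (11 <= beta (strong_power corner_F2 2))%N.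
Proof.
have -> : 11%N = size support2 by vm_compute.
apply: (@leq_beta_nat _ weight2 2); [by vm_compute|by vm_compute|move=> e].
rewrite [strong_power _ _]/= weak_edge_prod => /andP[].
case/weak_edge_corner=> x0 [y0 [l0 e0]] /weak_edge_corner [x1 [y1 [l1 e1]]].
have eE i : e i = (corner x0 y0 l0 i, corner x1 y1 l1 i).
  by rewrite -e0 -e1 !ffunE -surjective_pairing.
have /all_F2P/(_ x0)/all_F2P/(_ y0)/all_F2P/(_ l0)/all_F2P/(_ x1)
  /all_F2P/(_ y1)/all_F2P/(_ l1)/orP[h|/and3P[/eqP l00 /eqP l10 vS]] := table2_positive.
  by left; rewrite !eE !ffunE.
right; have {}eE i : e i = vertex2 x0 y0 x1 y1 by rewrite eE l00 l10 !corner0 !ffunE.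
by split; [apply/all_sameP => i j|]; rewrite !eE.
Qed.

Definition table3 : seq (seq (seq nat)) :=
  [:: [:: [:: 25; 23; 2; 23; 22; 14; 24; 22];
        [:: 23; 24; 3; 22; 25; 4; 15; 21];
        [:: 18; 7; 27; 5; 7; 27; 6; 5];
        [:: 13; 4; 29; 5; 5; 23; 7; 8];
        [:: 23; 24; 2; 22; 25; 12; 22; 25];
        [:: 12; 9; 29; 6; 10; 7; 11; 8];
        [:: 3; 10; 32; 9; 6; 11; 9; 7];
        [:: 22; 22; 2; 23; 24; 16; 20; 25]];
      [:: [:: 31; 6; 26; 27; 7; 12; 14; 5];
        [:: 13; 27; 5; 10; 14; 17; 10; 7];
        [:: 11; 24; 2; 7; 4; 22; 7; 11];
        [:: 14; 7; 28; 25; 6; 25; 11; 9];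
        [:: 5; 15; 26; 7; 28; 16; 5; 27];
        [:: 6; 7; 28; 7; 10; 23; 26; 7];
        [:: 6; 8; 28; 14; 7; 5; 24; 8];
        [:: 7; 5; 25; 11; 25; 16; 7; 27]];
      [:: [:: 30; 4; 5; 27; 4; 7; 8; 6];
        [:: 14; 29; 25; 14; 18; 12; 8; 5];
        [:: 23; 2; 4; 21; 22; 24; 20; 17];
        [:: 6; 22; 24; 3; 22; 25; 15; 23];
        [:: 5; 10; 5; 4; 30; 5; 6; 27];
        [:: 15; 17; 21; 20; 21; 3; 22; 18];
        [:: 24; 24; 26; 25; 20; 17; 0; 18];
        [:: 4; 6; 6; 7; 27; 9; 6; 30]]]%N.

Definition weight3 (i : nat) (v : vertex (strong_power corner_F2 3)) : nat :=
  lookup table3 i (v.1.1 + 2 * v.2.1.1 + 4 * v.2.2.1)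
                  (v.1.2 + 2 * v.2.1.2 + 4 * v.2.2.2).

Definition vertex3 (x0 y0 x1 y1 x2 y2 : 'F_2) : vertex (strong_power corner_F2 3) :=
  ((x0, y0), ((x1, y1), (x2, y2))).

Definition support3 : seq (vertex (strong_power corner_F2 3)) :=
  [seq v <- allpairs pair F2_pairs (allpairs pair F2_pairs F2_pairs)
  | weight3 0 v + weight3 1 v + weight3 2 v == 3 * 11]%N.

(** The same check for the cube, with 512 cases. *)
Lemma table3_positive :
  all_F2 (fun x0 => all_F2 (fun y0 => all_F2 (fun l0 =>
  all_F2 (fun x1 => all_F2 (fun y1 => all_F2 (fun l1 =>
  all_F2 (fun x2 => all_F2 (fun y2 => all_F2 (fun l2 =>
    (3 * 11 < weight3 0 (vertex3 x0 y0 x1 y1 x2 y2)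
      + weight3 1 (vertex3 (x0 + l0)%R y0 (x1 + l1)%R y1 (x2 + l2)%R y2)
      + weight3 2 (vertex3 x0 (y0 + l0)%R x1 (y1 + l1)%R x2 (y2 + l2)%R))%N
    || [&& l0 == 0, l1 == 0, l2 == 0 & vertex3 x0 y0 x1 y1 x2 y2 \in support3]))))))))).
Proof. by vm_compute. Qed.

Lemma beta_corner_F2_cube : (39 <= beta (strong_power corner_F2 3))%N.
Proof.
have -> : 39%N = size support3 by vm_compute.
apply: (@leq_beta_nat _ weight3 11); [by vm_compute|by vm_compute|move=> e].
rewrite [strong_power _ _]/= weak_edge_prod => /andP[].
case/weak_edge_corner=> x0 [y0 [l0 e0]]; rewrite weak_edge_prod => /andP[].
case/weak_edge_corner=> x1 [y1 [l1 e1]] /weak_edge_corner [x2 [y2 [l2 e2]]].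
have eE i : e i = (corner x0 y0 l0 i, (corner x1 y1 l1 i, corner x2 y2 l2 i)).
  by rewrite -e0 -e1 -e2 !ffunE; case: (e i) => ? [].
have /all_F2P/(_ x0)/all_F2P/(_ y0)/all_F2P/(_ l0)/all_F2P/(_ x1)
  /all_F2P/(_ y1)/all_F2P/(_ l1)/all_F2P/(_ x2)/all_F2P/(_ y2)/all_F2P/(_ l2)
  /orP[h|/and4P[/eqP l00 /eqP l10 /eqP l20 vS]] := table3_positive.
  by left; rewrite !eE !ffunE.
right; have {}eE i : e i = vertex3 x0 y0 x1 y1 x2 y2.
  by rewrite eE l00 l10 l20 !corner0 !ffunE.
by split; [apply/all_sameP => i j|]; rewrite !eE.
Qed.

Theorem theorem2p18 (R : realType) :
  [/\ (11 <= beta (strong_power (corner_hypergraph 'F_2) 2))%N,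
      (39 <= beta (strong_power (corner_hypergraph 'F_2) 3))%N
    & 39%:R `^ (3%:R^-1) <= shannon_capacity R (corner_hypergraph 'F_2)].
Proof.
split; [exact: beta_corner_F2_square|exact: beta_corner_F2_cube|].
(* The exponent is [m.+1], so [m = 2] selects the cube; monotonicity of the cube root then replaces
   [beta] by [39]. *)
apply: le_trans (shannon_capacity_ge_beta R (m := 2) (@loopless_corner 'F_2) _).
  by rewrite ge0_ler_powR ?nnegrE ?invr_ge0// ler_nat beta_corner_F2_cube.
exact: leq_trans beta_corner_F2_cube.
Qed.
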